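(* Let $n$ be a positive integer, let $a\in\mathbb{B}^n$, and let $f:\mathbb{B}^n\setminus\{0\}\to\mathbb{B}^n\setminus\{a\}$ be a Möbius map of $\mathbb{B}^n\setminus\{0\}$ onto $\mathbb{B}^n\setminus\{a\}$ with $f(0)=a$. Then for all $x,y\in\mathbb{B}^n\setminus\{0\}$, $$\frac{1-|a|}{1+|a|}\,\tilde{\tau}_{\mathbb{B}^n\setminus\{0\}}(x,y)\le \tilde{\tau}_{\mathbb{B}^n\setminus\{a\}}(f(x),f(y))\le \frac{1+|a|}{1-|a|}\,\tilde{\tau}_{\mathbb{B}^n\setminus\{0\}}(x,y).$$
   Context: $|\cdot|$ is the Euclidean norm on $\mathbb{R}^n$ and $\mathbb{B}^n=\{x\in\mathbb{R}^n:|x|<1\}$. For $b\in\mathbb{B}^n$ and $D=\mathbb{B}^n\setminus\{b\}$, whose boundary in $\mathbb{R}^n$ is $\partial D=\{b\}\cup\{p:|p|=1\}$, the scale invariant Cassinian metric is $$\tilde{\tau}_D(x,y)=\log\left(1+\sup_{p\in\partial D}\frac{|x-y|}{\sqrt{|x-p||p-y|}}\right),\quad x,y\in D.$$ A Möbius map is (the restriction of) a Möbius transformation of $\mathbb{R}^n\cup\{\infty\}$, i.e. a finite composition of inversions in spheres and reflections in hyperplanes; the condition $f(0)=a$ refers to the value at $0$ of this Möbius transformation. *)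

(* Defs.v *)
From HB Require Import structures.
From mathcomp Require Import all_boot all_order all_algebra.
From mathcomp Require Import all_classical all_reals all_analysis.

Set Implicit Arguments.
Unset Strict Implicit.
Unset Printing Implicit Defensive.

Import Order.TTheory GRing.Theory Num.Theory.
Import numFieldNormedType.Exports.

Local Open Scope classical_set_scope.
Local Open Scope ring_scope.

Section Defs.
Context {R : realType} {n : nat}.
Implicit Types (x y c u : 'rV[R]_n) (r t : R) (D : set 'rV[R]_n).

Definition edot x y : R := \sum_(i < n) x 0 i * y 0 i.

(* The library norm [`|x|] on row vectors is the sup norm. It induces the same
   topology as [enorm], so [closure] and [interior] below are the usual ones. *)
Definition enorm x : R := Num.sqrt (edot x x).

Definition uball : set 'rV[R]_n := [set x | enorm x < 1].

Definition boundary D : set 'rV[R]_n := closure D `\` interior D.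

(* For x, y in an open D with nonempty boundary, the supremum is that of a
   nonempty bounded set, hence a genuine one ([sup] defaults to 0 otherwise). *)
Definition scassinian D x y : R :=
  ln (1 + sup [set enorm (x - y) / Num.sqrt (enorm (x - p) * enorm (p - y))
              | p in boundary D]).

(* [None] is the point at infinity. *)
Local Notation Rnhat := (one_point_compactification 'rV[R]_n).

Definition inversion c r (z : Rnhat) : Rnhat :=
  match z with
  | Some x => if x == c then None
              else Some (c + (r ^+ 2 / enorm (x - c) ^+ 2) *: (x - c))
  | None => Some c
  end.

(* Reflection in the hyperplane of all x such that edot x u = t. *)
Definition reflection u t (z : Rnhat) : Rnhat :=
  match z with
  | Some x => Some (x - (2 * (edot x u - t) / enorm u ^+ 2) *: u)
  | None => None
  end.

Inductive mobius : (Rnhat -> Rnhat) -> Prop :=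
| mobius_id : mobius id
| mobius_inversion c r F : 0 < r -> mobius F -> mobius (inversion c r \o F)
| mobius_reflection u t F : u != 0 -> mobius F -> mobius (reflection u t \o F).

End Defs.

Arguments uball : clear implicits.

(* Main.v *)
Require Import Defs.
From HB Require Import structures.
From mathcomp Require Import all_boot all_order all_algebra.
From mathcomp Require Import all_classical all_reals all_analysis.
From mathcomp Require Import ring lra.

Set Implicit Arguments.
Unset Strict Implicit.
Unset Printing Implicit Defensive.

Import Order.TTheory GRing.Theory Num.Theory.
Import numFieldNormedType.Exports.

Local Open Scope classical_set_scope.
Local Open Scope ring_scope.

(** Let [K = (1 + |a|) / (1 - |a|)]. On the extended space, a Moebius map [F]
multiplies distances by a product of two local factors:
  [|F z - F w| = lam z * lam w * |z - w|],
where [|z - w|] is read as [1] when exactly one of the points is infinite.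
This property is stable under composition, so it is enough to check it for
reflections and inversions ([mobius_moebius_like]). In the quotient defining
the Cassinian metric, the factors then almost cancel: the quotient at
[F x, F y, F p] is the quotient at [x, y, p] times
[sqrt (lam x * lam y) / lam p] ([cassinian_ratio_map]).

The heart of the proof is that [lam] varies at most by the factor [K] on the
closed unit ball ([scale_ratio]). A map sending the unit ball onto itself sends
the unit sphere onto itself ([sphere_to_sphere]). For [u] on the sphere,
[lam u * lam 0 = |F u - F 0| = |F u - a|] lies between [1 - |a|] and
[1 + |a|], so the claim holds on the sphere. If [F] fixes infinity, [lam] is
constant. Otherwise [F] has a finite pole [b] outside the closed ball, and
[lam u] is inversely proportional to [|u - b|], so the extreme values of [lam]
on the closed ball are taken at the points [b / |b|] and [- b / |b|] of the
sphere.

The boundary of the ball punctured at [b] is the sphere together with [b]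
([boundary_punctured_ball]), so [F] maps the boundary of one domain onto the
boundary of the other. The two suprema are therefore within a factor [K] of each
other, and the inequality [ln (1 + K s) <= K ln (1 + s)] transfers this to the
metrics. *)

(** * The Euclidean norm on row vectors *)

Section EuclideanNorm.
Context {R : realType} {n : nat}.
Implicit Types (x y z : 'rV[R]_n) (t : R).

Lemma edotC x y : edot x y = edot y x.
Proof. by apply: eq_bigr => i _; rewrite mulrC. Qed.

Lemma edotDl x y z : edot (x + y) z = edot x z + edot y z.
Proof.
by rewrite /edot -big_split; apply: eq_bigr => i _; rewrite !mxE mulrDl.
Qed.

Lemma edotZl t x y : edot (t *: x) y = t * edot x y.
Proof.
by rewrite /edot mulr_sumr; apply: eq_bigr => i _; rewrite !mxE mulrA.
Qed.

Lemma edotNl x y : edot (- x) y = - edot x y.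
Proof. by rewrite -scaleN1r edotZl mulN1r. Qed.

Lemma edotBl x y z : edot (x - y) z = edot x z - edot y z.
Proof. by rewrite edotDl edotNl. Qed.

Lemma edotDr x y z : edot x (y + z) = edot x y + edot x z.
Proof. by rewrite edotC edotDl !(edotC _ x). Qed.

Lemma edotZr t x y : edot x (t *: y) = t * edot x y.
Proof. by rewrite edotC edotZl (edotC _ x). Qed.

Lemma edotBr x y z : edot x (y - z) = edot x y - edot x z.
Proof. by rewrite edotC edotBl !(edotC _ x). Qed.

Lemma edot_ge0 x : 0 <= edot x x.
Proof. by apply: sumr_ge0 => i _; rewrite -expr2 sqr_ge0. Qed.

Lemma edot_eq0 x : (edot x x == 0) = (x == 0).
Proof.
apply/idP/eqP => [|->]; last first.
  by rewrite /edot big1// => i _; rewrite mxE mul0r.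
rewrite /edot psumr_eq0 => [/allP x0|i _]; last by rewrite -expr2 sqr_ge0.
apply/rowP => i; have /implyP/(_ isT) := x0 i (mem_index_enum _).
by rewrite mulf_eq0 orbb mxE => /eqP.
Qed.

Lemma enorm_ge0 x : 0 <= enorm x.
Proof. exact: sqrtr_ge0. Qed.

Lemma sqr_enorm x : enorm x ^+ 2 = edot x x.
Proof. by rewrite sqr_sqrtr ?edot_ge0. Qed.

Lemma enorm_eq0 x : (enorm x == 0) = (x == 0).
Proof. by rewrite -edot_eq0 -sqr_enorm sqrf_eq0. Qed.

Lemma enorm0 : enorm (0 : 'rV[R]_n) = 0.
Proof. by apply/eqP; rewrite enorm_eq0. Qed.

Lemma enorm_gt0 x : (0 < enorm x) = (x != 0).
Proof. by rewrite lt_neqAle enorm_ge0 andbT eq_sym enorm_eq0. Qed.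

Lemma enormZ t x : enorm (t *: x) = `|t| * enorm x.
Proof.
by rewrite /enorm edotZl edotZr mulrA -expr2 sqrtrM ?sqr_ge0// sqrtr_sqr.
Qed.

Lemma enormN x : enorm (- x) = enorm x.
Proof. by rewrite -scaleN1r enormZ normrN1 mul1r. Qed.

Lemma enorm_distC x y : enorm (x - y) = enorm (y - x).
Proof. by rewrite -enormN opprB. Qed.

(** Cauchy-Schwarz, from the nonnegativity of the squared norm of
[|y| x - |x| y]. *)
Lemma edot_le_enorm x y : edot x y <= enorm x * enorm y.
Proof.
have [->|x0] := eqVneq x 0.
  by rewrite -(scale0r 0) edotZl enormZ !(normr0, mul0r).
have [->|y0] := eqVneq y 0.
  by rewrite -(scale0r 0) edotZr enormZ !(normr0, mul0r, mulr0).
have := edot_ge0 (enorm y *: x - enorm x *: y).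
rewrite !edotBl !edotBr !edotZl !edotZr -!sqr_enorm (edotC y x).
have xy0 : 0 < enorm x * enorm y by rewrite mulr_gt0 ?enorm_gt0.
rewrite [X in 0 <= X](_ : _ =
  2 * (enorm x * enorm y) * (enorm x * enorm y - edot x y)); last by ring.
by rewrite pmulr_rge0 ?subr_ge0// mulr_gt0.
Qed.

Lemma enormD x y : enorm (x + y) <= enorm x + enorm y.
Proof.
rewrite -ler_sqr ?nnegrE ?addr_ge0 ?enorm_ge0//.
rewrite sqr_enorm edotDl !edotDr (edotC y x) sqrrD !sqr_enorm.
have := edot_le_enorm x y; lra.
Qed.

Lemma enormB_le x y : enorm (x - y) <= enorm x + enorm y.
Proof. by rewrite (le_trans (enormD _ _)) ?enormN. Qed.

Lemma enormB_ge x y : enorm x - enorm y <= enorm (x - y).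
Proof. by rewrite lerBlDr -{1}(subrK y x) enormD. Qed.

Lemma continuous_enorm : continuous (@enorm R n).
Proof.
have cedot : continuous (fun x : 'rV[R]_n => edot x x).
  apply: continuous_big => [|i _ x]; first exact: add_continuous.
  by apply: continuousM; exact: coord_continuous.
by move=> x; apply: continuous_comp; [exact: cedot|exact: sqrt_continuous].
Qed.

End EuclideanNorm.

(** * Moebius maps scale distances by a product of local factors *)

Section ExtendedSpace.
Context {R : realType} {n : nat}.
Local Notation Rnhat := (one_point_compactification 'rV[R]_n).
Implicit Types (x y c u v : 'rV[R]_n) (r t : R) (z w : Rnhat).

(** The factor attached to infinity is replaced by [1], as is usual in absolute
cross-ratios. This is not a metric, but with this convention the scaling law of
Moebius maps has no exception at poles or at infinity. *)
Definition hdist (z w : Rnhat) : R :=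
  match z, w with
  | Some x, Some y => enorm (x - y)
  | None, None => 0
  | _, _ => 1
  end.

Lemma hdistC z w : hdist z w = hdist w z.
Proof. by case: z w => [x|] [y|]//=; exact: enorm_distC. Qed.

Lemma reflectionK u t : u != 0 -> involutive (reflection u t).
Proof.
move=> u0 [x|]//=; congr Some; rewrite sqr_enorm edotBl edotZl.
have u2 : edot u u != 0 by rewrite edot_eq0.
rewrite -addrA -opprD -scalerDl [X in X *: _](_ : _ = 0) ?scale0r ?subr0//.
by field.
Qed.

Lemma hdist_reflection u t z w :
  u != 0 -> hdist (reflection u t z) (reflection u t w) = hdist z w.
Proof.
move=> u0; case: z w => [x|] [y|]//=.
have u2 : edot u u != 0 by rewrite edot_eq0.
rewrite (_ : _ - _ = (x - y) - (2 * edot (x - y) u / edot u u) *: u);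
  last first.
  rewrite sqr_enorm edotBl (opprD y) addrACA; congr (_ + _).
  by rewrite opprK addrC -scalerBl -[RHS]scaleNr; congr (_ *: _); field.
rewrite /enorm; congr Num.sqrt; move: (x - y) => v.
by rewrite edotBl !edotBr !edotZl !edotZr (edotC u v); field.
Qed.

(** Away from [c], this is the square root of the linear dilatation
[r ^+ 2 / |x - c| ^+ 2] of the inversion; the values at [c] and at infinity are
those forced by the scaling law. *)
Definition invscale c r (z : Rnhat) : R :=
  match z with
  | Some x => if x == c then r^-1 else r / enorm (x - c)
  | None => r
  end.

Lemma invscale_gt0 c r z : 0 < r -> 0 < invscale c r z.
Proof.
move=> r0; case: z => [x|]//=; case: eqVneq => [_|xc].
  by rewrite invr_gt0.
by rewrite divr_gt0// enorm_gt0 subr_eq0.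
Qed.

Lemma inversionK c r : 0 < r -> involutive (inversion c r).
Proof.
move=> r0 [x|] /=; last by rewrite eqxx.
have [->//|xc] := eqVneq x c.
have x0 : x - c != 0 by rewrite subr_eq0.
have e0 : enorm (x - c) != 0 by rewrite enorm_eq0.
have k0 : r ^+ 2 / enorm (x - c) ^+ 2 != 0.
  by rewrite mulf_neq0 ?invr_eq0 ?expf_neq0// gt_eqF.
have yc : c + (r ^+ 2 / enorm (x - c) ^+ 2) *: (x - c) != c.
  by rewrite -subr_eq0 addrAC subrr add0r scaler_eq0 negb_or k0.
rewrite /= (negbTE yc) [c + _ - c]addrAC subrr add0r enormZ scalerA.
congr Some; rewrite [X in X *: _](_ : _ = 1) ?scale1r ?subrKC//.
rewrite ger0_norm ?divr_ge0 ?sqr_ge0//.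
by field; rewrite e0 gt_eqF.
Qed.

Lemma enorm_inv_dist r u v : 0 < r -> u != 0 -> v != 0 ->
  enorm ((r ^+ 2 / enorm u ^+ 2) *: u - (r ^+ 2 / enorm v ^+ 2) *: v) =
  r / enorm u * (r / enorm v) * enorm (u - v).
Proof.
move=> r0 u0 v0.
have u1 : enorm u != 0 by rewrite enorm_eq0.
have v1 : enorm v != 0 by rewrite enorm_eq0.
have k0 : 0 <= r / enorm u * (r / enorm v).
  by rewrite !mulr_ge0 ?invr_ge0 ?enorm_ge0 ?ltW.
rewrite -[r / enorm u * (r / enorm v)](ger0_norm k0) -enormZ; congr Num.sqrt.
rewrite !edotZl !edotZr !edotBl !edotBr !edotZl !edotZr -!sqr_enorm (edotC v u).
by field; rewrite u1 v1.
Qed.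

(** When both points are finite and different from the center, this is the
classical distance formula for inversions; otherwise the conventions for
[hdist] and [invscale] at infinity and at the center make it hold. *)
Lemma hdist_inversion c r z w : 0 < r ->
  hdist (inversion c r z) (inversion c r w) =
  invscale c r z * invscale c r w * hdist z w.
Proof.
(* By symmetry, the case of an infinite [z] and a finite [w] can be left out. *)
move=> r0; wlog: z w / if z is Some _ then true else ~~ w.
  move=> hw; case: z w => [x|] [y|]; try exact: hw.
  by rewrite hdistC hw// (mulrC (invscale c r None)) (hdistC None).
have rN : r != 0 by rewrite gt_eqF.
case: z w => [x|] [y|]//= _; last by rewrite subrr enorm0 mulr0.
- have [->|xc] := eqVneq x c; have [->|yc] := eqVneq y c => /=.
  + by rewrite subrr enorm0 mulr0.
  + rewrite (enorm_distC c) mulrA mulVf// mul1r mulVf// enorm_eq0 subr_eq0//.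
  + rewrite mulrAC divfK ?divff// enorm_eq0 subr_eq0//.
  + rewrite opprD addrACA subrr add0r enorm_inv_dist ?subr_eq0//.
    by rewrite opprB addrA subrK.
- have [_|xc] := eqVneq x c => /=; first by rewrite mulVf// mulr1.
  have e0 : enorm (x - c) != 0 by rewrite enorm_eq0 subr_eq0.
  rewrite addrAC subrr add0r enormZ mulr1 ger0_norm ?divr_ge0 ?sqr_ge0//.
  by field.
Qed.

(** The only properties of a Moebius map used in the estimates: it is invertible
and scales [hdist] by a product of positive local factors. *)
Record moebius_like (F G : Rnhat -> Rnhat) (lam : Rnhat -> R) : Prop :=
  MoebiusLike {
    moebiusK : cancel F G;
    moebiusVK : cancel G F;
    scale_gt0 : forall z, 0 < lam z;
    hdist_scale : forall z w, hdist (F z) (F w) = lam z * lam w * hdist z w }.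

(** Inclusions proved for such maps, applied to [G], give the surjectivity of [F]
on the sphere. *)
Lemma moebius_likeV F G lam :
  moebius_like F G lam -> moebius_like G F (fun z => (lam (G z))^-1).
Proof.
case=> FK GK lam0 hd; split=> // [z|z w]; first by rewrite invr_gt0.
have -> : hdist z w = lam (G z) * lam (G w) * hdist (G z) (G w).
  by rewrite -hd !GK.
by field; rewrite !gt_eqF.
Qed.

(** The local factor of a composite is the product of the factors along the
orbit, as in the chain rule. *)
Lemma mobius_moebius_like F :
  mobius F -> exists G lam, moebius_like F G lam.
Proof.
elim=> [|c r {}F r0 _ [G [lam [FK GK lam0 hd]]]
        |u t {}F u0 _ [G [lam [FK GK lam0 hd]]]].
- by exists id, (fun=> 1); split=> // z w; rewrite !mul1r.
- exists (G \o inversion c r), (fun z => invscale c r (F z) * lam z).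
  split=> [z|z|z|z w] /=.
  + by rewrite inversionK.
  + by rewrite GK inversionK.
  + by rewrite mulr_gt0// invscale_gt0.
  + by rewrite hdist_inversion// hd; ring.
- exists (G \o reflection u t), lam; split=> [z|z|//|z w] /=.
  + by rewrite reflectionK.
  + by rewrite GK reflectionK.
  + by rewrite hdist_reflection.
Qed.

End ExtendedSpace.

Arguments hdist {R n} !z !w.

(** * The Cassinian metric of a punctured ball *)

(** Concavity of the logarithm at [1 + s], which is the barycenter of
[1 + k * s] and [1] with weights [k^-1] and [1 - k^-1]. *)
Lemma ln1DM_le {R : realType} (k s : R) :
  1 <= k -> 0 <= s -> ln (1 + k * s) <= k * ln (1 + s).
Proof.
move=> k1 s0; have k0 : 0 < k by rewrite (lt_le_trans ltr01).
have ki : k^-1 <= 1 by rewrite invf_le1.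
have ks : 0 < 1 + k * s by rewrite ltr_wpDr// mulr_ge0// ltW.
have := @concave_ln _ (Itv01 (eqbRL (invr_ge0 _) (ltW k0)) ki) _ _ ks ltr01.
rewrite !convRE/= ln1 mulr0 addr0 ler_pdivrMl//.
suff -> : k^-1 * (1 + k * s) + (1 - k^-1) * 1 = 1 + s by [].
by field; rewrite gt_eqF.
Qed.

Section Cassinian.
Context {R : realType} {n : nat}.
Implicit Types (x y p b u v : 'rV[R]_n) (k : R) (D : set 'rV[R]_n).

(** Boundary points of the punctured ball are approached along segments, which
avoids balls of the sup norm altogether. *)
Lemma closure_ray D u v :
  (\forall t \near 0^'+, D (u + t *: v)) -> closure D u.
Proof.
move=> Dt; apply: (@closed_cvg _ _ (at_right (0 : R)) _ (fun t => u + t *: v)).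
- exact: closed_closure.
- by apply: filterS Dt => t; exact: subset_closure.
- rewrite -[X in _ --> X]addr0 -(scale0r v).
  apply: cvg_at_right_filter; apply: cvgD; first exact: cvg_cst.
  by apply: cvgZr_tmp; exact: cvg_id.
Qed.

(** In dimension [0] the ball punctured at its center is empty, and so is its
boundary; a positive dimension supplies a direction in which to approach
[b]. *)
Lemma boundary_punctured_ball b : (0 < n)%N -> uball R n b ->
  boundary (uball R n `\ b) = [set b] `|` [set p | enorm p = 1].
Proof.
move=> n0 b1.
have oD : open (uball R n `\ b).
  apply: openI; last first.
    apply: closed_openC; apply: accessible_closed_set1.
    exact/hausdorff_accessible/norm_hausdorff.
  by apply: open_comp (@open_lt R 1) => x _; exact: continuous_enorm.
have cB : closed [set x : 'rV[R]_n | enorm x <= 1].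
  by apply: preimage_closed (@closed_le R 1) => x _; exact: continuous_enorm.
rewrite /boundary (iffLR (interior_id _) oD).
apply/seteqP; split=> [p [cp Dp]|p [->|/= p1]].
- have /= p1 : enorm p <= 1.
    apply: cB; apply: closureS cp => x [/= /ltW]//.
  have [->|pb] := eqVneq p b; [by left|right => /=].
  apply/eqP; rewrite eq_le p1 leNgt; apply/negP => pl1; apply: Dp; split=> //.
  exact/eqP.
- split; last by case=> _; exact.
  (* Any nonzero direction works for approaching the puncture. *)
  pose e : 'rV[R]_n := delta_mx 0 (Ordinal n0).
  have e0 : e != 0.
    by apply/eqP => /rowP/(_ (Ordinal n0))/eqP; rewrite !mxE !eqxx oner_eq0.
  apply: (@closure_ray _ _ ((enorm e)^-1 *: e)); near=> t.
  have t0 : 0 < t by near: t; exact: nbhs_right_gt.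
  have t1 : t < 1 - enorm b.
    by near: t; apply: nbhs_right_lt; rewrite subr_gt0.
  split => /=.
    rewrite /uball /= (le_lt_trans (enormD _ _))// enormZ enormZ.
    rewrite (gtr0_norm t0) ger0_norm ?invr_ge0 ?enorm_ge0// mulVf ?enorm_eq0//.
    by rewrite mulr1 -ltrBrDl.
  move/eqP; rewrite -subr_eq0 addrAC subrr add0r scaler_eq0 gt_eqF//=.
  by rewrite scaler_eq0 invr_eq0 enorm_eq0 (negbTE e0).
- split; last by case; rewrite /uball /= p1 ltxx.
  (* Along the radius to [p], the norm [1 - t] eventually exceeds [|b|], so the
     puncture is avoided. *)
  apply: (@closure_ray _ _ (- p)); near=> t.
  have t0 : 0 < t by near: t; exact: nbhs_right_gt.
  have t1 : t < 1 - enorm b.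
    by near: t; apply: nbhs_right_lt; rewrite subr_gt0.
  have pt : enorm (p + t *: - p) = 1 - t.
    rewrite scalerN -scaleNr -{1}(scale1r p) -scalerDl enormZ p1 mulr1.
    by rewrite ger0_norm// subr_ge0 (le_trans (ltW t1))// gerBl enorm_ge0.
  split => /=; first by rewrite /uball /=; lra.
  by move=> pb; move: pt; rewrite pb; lra.
Unshelve. all: by end_near. Qed.

Definition cassinian_ratio x y p :=
  enorm (x - y) / Num.sqrt (enorm (x - p) * enorm (p - y)).

Lemma cassinian_ratio_ge0 x y p : 0 <= cassinian_ratio x y p.
Proof. by rewrite divr_ge0 ?enorm_ge0 ?sqrtr_ge0. Qed.

(** Keeps the denominators of the Cassinian quotients away from zero, uniformly
in the boundary point. *)
Lemma dist_boundary_ge b x : (0 < n)%N -> uball R n b -> (uball R n `\ b) x ->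
  exists2 m, 0 < m &
    forall p, boundary (uball R n `\ b) p -> m <= enorm (x - p).
Proof.
move=> n0 b1 [/= x1 /eqP xb].
exists (Num.min (1 - enorm x) (enorm (x - b))).
  by rewrite lt_min subr_gt0 enorm_gt0 subr_eq0 xb andbT.
move=> p; rewrite boundary_punctured_ball// => -[->|/= p1].
  by rewrite ge_min lexx orbT.
by rewrite ge_min enorm_distC -[X in X - _]p1 enormB_ge.
Qed.

Lemma cassinian_ratio_bounded b x y : (0 < n)%N -> uball R n b ->
  (uball R n `\ b) x -> (uball R n `\ b) y ->
  has_ubound [set cassinian_ratio x y p | p in boundary (uball R n `\ b)].
Proof.
move=> n0 b1 Dx Dy.
have [r r0 hr] := dist_boundary_ge n0 b1 Dx.
have [s s0 hs] := dist_boundary_ge n0 b1 Dy.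
exists (enorm (x - y) / Num.sqrt (r * s)) => _ [p bp <-].
apply: ler_wpM2l; first exact: enorm_ge0.
have rs0 : 0 < Num.sqrt (r * s) by rewrite sqrtr_gt0 mulr_gt0.
have rs : Num.sqrt (r * s) <= Num.sqrt (enorm (x - p) * enorm (p - y)).
  by rewrite ler_wsqrtr// ler_pM ?(ltW r0) ?(ltW s0) ?hr// enorm_distC hs.
by rewrite lef_pV2 ?posrE// (lt_le_trans rs0).
Qed.

(** A pointwise comparison of the quotients, with the boundary points matched in
an arbitrary way, passes to the suprema and then, by [ln1DM_le], to the
metrics. *)
Lemma scassinian_le k D D' x y x' y' : 1 <= k ->
  has_ubound [set cassinian_ratio x y p | p in boundary D] ->
  boundary D' !=set0 ->
  (forall p', boundary D' p' -> exists2 p, boundary D p &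
     cassinian_ratio x' y' p' <= k * cassinian_ratio x y p) ->
  scassinian D' x' y' <= k * scassinian D x y.
Proof.
move=> k1 ub [p0' bp0'] le_ratio; rewrite /scassinian.
set A := [set _ | _ in boundary D]; set A' := [set _ | _ in boundary D'].
have k0 : 0 <= k by rewrite (le_trans ler01).
have A0 q : boundary D q -> cassinian_ratio x y q <= sup A.
  by move=> bq; apply: ub_le_sup => //; exists q.
have A'A : sup A' <= k * sup A.
  apply: ge_sup; first by exists (cassinian_ratio x' y' p0'); exists p0'.
  move=> _ [p' /le_ratio[p bp] le_p <-].
  by rewrite (le_trans le_p)// ler_wpM2l// A0.
have supA0 : 0 <= sup A.
  have [p bp _] := le_ratio _ bp0'.
  by rewrite (le_trans (cassinian_ratio_ge0 x y p))// A0.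
have supA'0 : 0 <= sup A'.
  rewrite (le_trans (cassinian_ratio_ge0 x' y' p0'))//.
  apply: ub_le_sup; last by exists p0'.
  exists (k * sup A) => _ [p' /le_ratio[p bp] le_p <-].
  by rewrite (le_trans le_p)// ler_wpM2l// A0.
rewrite (le_trans _ (ln1DM_le k1 supA0))//.
by rewrite ler_ln ?posrE ?lerD2l// ltr_wpDr// mulr_ge0.
Qed.

End Cassinian.

(** * Moebius maps preserving the unit ball *)

Section BallMap.
Context {R : realType} {n : nat}.
Local Notation Rnhat := (one_point_compactification 'rV[R]_n).
Implicit Types (x y p a b : 'rV[R]_n) (z : Rnhat).

Definition hball z : bool := if z is Some x then enorm x < 1 else false.

(** The images of the points [t *: p], with [t < 1] tending to [1], stay in the
ball and tend to [F p]: the factors [lam (t *: p)] stay bounded, because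
[lam (t *: p) * lam 0 * t = |F (t *: p) - F 0| <= 2]. This is a quantitative
form of the continuity of [F], which also excludes that [F p] is infinite. *)
Lemma sphere_to_closed_ball F G (lam : Rnhat -> R) p :
  moebius_like F G lam -> (forall z, hball z -> hball (F z)) ->
  enorm p = 1 -> exists2 q, F (Some p) = Some q & enorm q <= 1.
Proof.
case=> _ _ lam0 hd ball p1.
pose C := 2 * lam (Some p) / lam (Some 0).
have C0 : 0 < C by rewrite divr_gt0 ?mulr_gt0.
(* With [t = (1 + s)^-1] one has [1 - t = t * s], so that
   [|F (t *: p) - F p| = lam (t *: p) * lam p * t * s <= C * s]. *)
have approx s : 0 < s ->
    exists2 w, enorm w < 1 & hdist (Some w) (F (Some p)) <= C * s.
  move=> s0; pose t := (1 + s)^-1.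
  have s1 : 0 < 1 + s by rewrite addr_gt0.
  have t0 : 0 < t by rewrite invr_gt0.
  have ts : 1 - t = t * s by rewrite /t; field; rewrite gt_eqF.
  have tp : enorm (t *: p) = t by rewrite enormZ p1 mulr1 gtr0_norm.
  have t1 : t < 1 by rewrite -subr_gt0 ts mulr_gt0.
  have := ball (Some (t *: p)); rewrite /= tp => /(_ t1).
  have := ball (Some 0); rewrite /= enorm0 => /(_ ltr01).
  case Fw : (F (Some (t *: p))) => [w|//]; case F0 : (F (Some 0)) => [a|//] /=.
  move=> a1 w1; exists w; first exact: w1.
  rewrite -Fw hd /=.
  have lt2 : lam (Some (t *: p)) * lam (Some 0) * t <= 2.
    have := hd (Some (t *: p)) (Some 0); rewrite Fw F0 /= subr0 tp => <-.
    by have := enormB_le w a; lra.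
  rewrite (_ : enorm (t *: p - p) = t * s); last first.
    rewrite enorm_distC -{1}(scale1r p) -scalerBl enormZ p1 ts mulr1.
    by rewrite gtr0_norm// mulr_gt0.
  pose q := lam (Some p) / lam (Some 0) * s.
  rewrite (_ : C * s = 2 * q); last by rewrite /C /q; ring.
  rewrite [leLHS](_ : _ = lam (Some (t *: p)) * lam (Some 0) * t * q).
    by rewrite ler_wpM2r// mulr_ge0 ?divr_ge0 ?ltW.
  by rewrite /q; field; rewrite gt_eqF.
case Fp : (F (Some p)) => [q|]; last first.
  have [|w _] := approx (2 * C)^-1; first by rewrite invr_gt0 mulr_gt0.
  rewrite Fp /= invfM mulrCA divff ?gt_eqF//; lra.
exists q => //; apply/ler_addgt0Pr => e e0.
have [|w w1] := approx (e / C); first by rewrite divr_gt0.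
rewrite Fp /= mulrC divfK ?gt_eqF// enorm_distC => qw.
by have := enormB_ge q w; lra.
Qed.

Section BallAutomorphism.
Variables (F G : Rnhat -> Rnhat) (lam : Rnhat -> R).
Hypothesis FG : moebius_like F G lam.
Hypothesis ballF : forall z, hball (F z) <-> hball z.

(** The image of a point of the sphere is in the closed ball by
[sphere_to_closed_ball], and not in the open ball since [F] also reflects
membership in it. *)
Lemma sphere_to_sphere p :
  enorm p = 1 -> exists2 q, F (Some p) = Some q & enorm q = 1.
Proof.
move=> p1.
have [|q Fp q1] := sphere_to_closed_ball FG _ p1; first by move=> z /ballF.
exists q => //; apply/eqP; rewrite eq_le q1 leNgt; apply/negP => ql1.
have /ballF/= : hball (F (Some p)) by rewrite Fp.
by rewrite p1 ltxx.
Qed.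

Lemma closed_ball_finite x : enorm x <= 1 -> exists x', F (Some x) = Some x'.
Proof.
rewrite le_eqVlt => /orP[/eqP/sphere_to_sphere[q -> _]|x1]; first by exists q.
have /ballF : hball (Some x) by [].
by case: (F _) => // x' _; exists x'.
Qed.

(** On the sphere, [lam u * lam 0 = |F u - a|] is between [1 - |a|] and
[1 + |a|]. The extreme values of [lam] on the closed ball are attained on the
sphere, because [lam u] is inversely proportional to the distance from [u] to
the pole [b], or constant if the pole is infinite. *)
Lemma scale_ratio a x p : F (Some 0) = Some a -> enorm a < 1 ->
  enorm x <= 1 -> enorm p <= 1 ->
  lam (Some x) <= (1 + enorm a) / (1 - enorm a) * lam (Some p).
Proof.
case: (FG) => FK GK lam0 hd F0 a1 x1 p1.
set K := _ / _.
have a0 := enorm_ge0 a.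
have K1 : 1 <= K by rewrite ler_pdivlMr; lra.
have Ka : K * (1 - enorm a) = 1 + enorm a.
  by rewrite divfK// gt_eqF// subr_gt0.
have sphere u : enorm u = 1 ->
    1 - enorm a <= lam (Some u) * lam (Some 0) <= 1 + enorm a.
  move=> u1; have [q Fu q1] := sphere_to_sphere u1.
  have := hd (Some u) (Some 0); rewrite Fu F0 /= subr0 u1 mulr1 => <-.
  by have := enormB_ge q a; have := enormB_le q a; rewrite q1 => -> ->.
have on_sphere u v : enorm u = 1 -> enorm v = 1 ->
    lam (Some u) <= K * lam (Some v).
  move=> /sphere/andP[_ u1] /sphere/andP[v1 _].
  rewrite -(ler_pM2r (lam0 (Some 0))) (le_trans u1)// -mulrA -Ka.
  by rewrite ler_wpM2l// (le_trans ler01).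
case Gb : (G None) => [b|]; last first.
  have FN : F None = None by rewrite -{1}Gb GK.
  have N1 u : enorm u <= 1 -> lam (Some u) * lam None = 1.
    move=> /closed_ball_finite[u' Fu].
    by have := hd (Some u) None; rewrite Fu FN /= mulr1.
  have -> : lam (Some x) = lam (Some p).
    by apply: (@mulIf _ (lam None)); rewrite ?gt_eqF// !N1.
  by rewrite ler_peMl// ltW.
have Fb : F (Some b) = None by rewrite -Gb GK.
have b1 : 1 < enorm b.
  by rewrite ltNge; apply/negP => /closed_ball_finite[b']; rewrite Fb.
have b0 : enorm b != 0 by rewrite gt_eqF// (lt_trans ltr01).
have pole u : enorm u <= 1 -> lam (Some u) * lam (Some b) * enorm (u - b) = 1.
  move=> /closed_ball_finite[u' Fu].
  by have := hd (Some u) (Some b); rewrite Fu Fb.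
have monotone u v : enorm u <= 1 -> enorm v <= 1 ->
    enorm (u - b) <= enorm (v - b) -> lam (Some v) <= lam (Some u).
  move=> u1 v1 uv.
  have ub : 0 < enorm (u - b).
    rewrite enorm_distC (lt_le_trans _ (enormB_ge _ _))//; lra.
  rewrite -(ler_pM2r (lam0 (Some b))) -(ler_pM2r ub) pole// -(pole v)//.
  by rewrite ler_wpM2l// mulr_ge0 ?ltW.
(* Among the points of the closed ball, [e] is the closest to the pole and
   [- e] is the farthest from it. *)
pose e := (enorm b)^-1 *: b.
have e1 : enorm e = 1.
  by rewrite enormZ ger0_norm ?invr_ge0 ?enorm_ge0// mulVf.
have eb t : t *: e - b = (t - enorm b) *: e.
  by rewrite scalerBl [enorm b *: e]scalerA divff// scale1r.
have near : enorm (e - b) = enorm b - 1.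
  by rewrite -{1}(scale1r e) eb enormZ e1 mulr1 ler0_norm ?opprB//; lra.
have far : enorm (- e - b) = enorm b + 1.
  by rewrite -scaleN1r eb enormZ e1 mulr1 ler0_norm; lra.
have Ne1 : enorm (- e) = 1 by rewrite enormN.
apply: (@le_trans _ _ (lam (Some e))).
  apply: monotone; rewrite ?e1// near enorm_distC.
  by have := enormB_ge b x; lra.
apply: (le_trans (on_sphere _ _ e1 Ne1)).
rewrite ler_wpM2l ?(le_trans ler01)//.
apply: monotone; rewrite ?Ne1// far.
by have := enormB_le p b; lra.
Qed.

(** The numerator is scaled by [lam x * lam y] and the denominator by
[lam p * sqrt (lam x * lam y)]. *)
Lemma cassinian_ratio_map x y p x' y' p' :
  F (Some x) = Some x' -> F (Some y) = Some y' -> F (Some p) = Some p' ->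
  cassinian_ratio x' y' p' =
    Num.sqrt (lam (Some x) * lam (Some y)) / lam (Some p) *
    cassinian_ratio x y p.
Proof.
case: FG => _ _ lam0 hd Fx Fy Fp.
have := hd (Some x) (Some y); rewrite Fx Fy /= /cassinian_ratio => ->.
have := hd (Some x) (Some p); rewrite Fx Fp /= => ->.
have := hd (Some p) (Some y); rewrite Fp Fy /= => ->.
have lx := lam0 (Some x); have ly := lam0 (Some y); have lp := lam0 (Some p).
move: (lam _) (lam (Some y)) (lam (Some p)) lx ly lp => r s t r0 s0 t0.
set d := enorm (x - y).
rewrite [X in _ / Num.sqrt X = _](_ : _ =
    r * s * t ^+ 2 * (enorm (x - p) * enorm (p - y)));
  last by ring.
have rs0 : 0 < Num.sqrt (r * s) by rewrite sqrtr_gt0 mulr_gt0.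
rewrite (sqrtrM (enorm (x - p) * _)) ?mulr_ge0 ?sqr_ge0 ?ltW//.
rewrite (sqrtrM (t ^+ 2)) ?mulr_ge0 ?ltW// sqrtr_sqr (gtr0_norm t0).
rewrite -[X in X * d](@sqr_sqrtr _ (r * s)) ?mulr_ge0 ?ltW// !invfM.
move: (Num.sqrt (enorm (x - p) * enorm (p - y)))^-1 => q.
by field; rewrite !gt_eqF.
Qed.

(** Both bounds follow from [scale_ratio], since the geometric mean of [lam x]
and [lam y] lies between them. *)
Lemma cassinian_ratio_bound a x y p x' y' p' :
  F (Some 0) = Some a -> enorm a < 1 ->
  enorm x <= 1 -> enorm y <= 1 -> enorm p <= 1 ->
  F (Some x) = Some x' -> F (Some y) = Some y' -> F (Some p) = Some p' ->
  let K := (1 + enorm a) / (1 - enorm a) in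
  cassinian_ratio x' y' p' <= K * cassinian_ratio x y p /\
  cassinian_ratio x y p <= K * cassinian_ratio x' y' p'.
Proof.
move=> F0 a1 x1 y1 p1 Fx Fy Fp K; rewrite (cassinian_ratio_map Fx Fy Fp).
have lam0 := scale_gt0 FG.
have K0 : 0 < K by rewrite divr_gt0 ?subr_gt0// ltr_wpDr ?enorm_ge0.
have geomean_le r s t : 0 <= r -> 0 <= s -> r <= t -> s <= t ->
    Num.sqrt (r * s) <= t.
  move=> r0 s0 rt st; have t0 := le_trans r0 rt.
  by rewrite -(ger0_norm t0) -sqrtr_sqr ler_wsqrtr// expr2 ler_pM.
have geomean_ge r s t : 0 <= t -> t <= r -> t <= s -> t <= Num.sqrt (r * s).
  move=> t0 tr ts.
  by rewrite -(ger0_norm t0) -sqrtr_sqr ler_wsqrtr// expr2 ler_pM.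
split.
  rewrite ler_wpM2r ?cassinian_ratio_ge0// ler_pdivrMr//.
  by apply: geomean_le; [exact/ltW|exact/ltW|exact: scale_ratio..].
rewrite mulrA ler_peMl ?cassinian_ratio_ge0// mulrA ler_pdivlMr// mul1r.
rewrite -ler_pdivrMl//; apply: geomean_ge; rewrite ?ler_pdivrMl//;
  try exact: scale_ratio.
by rewrite mulr_ge0 ?invr_ge0 ?ltW.
Qed.

End BallAutomorphism.
End BallMap.

(** * The distortion of the Cassinian metric *)

Theorem theorem2p1 (R : realType) (n : nat) (hn : (0 < n)%N)
  (a : 'rV[R]_n) (ha : uball R n a)
  (f : 'rV[R]_n -> 'rV[R]_n)
  (F : one_point_compactification 'rV[R]_n ->
       one_point_compactification 'rV[R]_n)
  (hF : mobius F)
  (hFf : forall x : 'rV[R]_n, (uball R n `\ 0) x -> F (Some x) = Some (f x))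
  (hf : f @` (uball R n `\ 0) = uball R n `\ a)
  (hF0 : F (Some 0) = Some a)
  (x y : 'rV[R]_n) (hx : (uball R n `\ 0) x) (hy : (uball R n `\ 0) y) :
  (1 - enorm a) / (1 + enorm a) * scassinian (uball R n `\ 0) x y
    <= scassinian (uball R n `\ a) (f x) (f y) /\
  scassinian (uball R n `\ a) (f x) (f y)
    <= (1 + enorm a) / (1 - enorm a) * scassinian (uball R n `\ 0) x y.
Proof.
have [G [lam FG]] := mobius_moebius_like hF.
have [FK GK _ _] := FG.
have a1 : enorm a < 1 := ha.
have a0 := enorm_ge0 a.
have zero_ball : uball R n 0 by rewrite /uball /= enorm0.
have fD u : (uball R n `\ 0) u -> (uball R n `\ a) (f u).
  by move=> Du; rewrite -hf; exists u.
(* The given map is only constrained on the punctured ball; together with its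
   value at [0], this determines the preimage of the whole ball. *)
have ballF z : hball (F z) <-> hball z.
  split=> [|].
    case Fz : (F z) => [w|//] /= w1; have [wa|/eqP wa] := eqVneq w a.
      have -> : z = Some 0 by rewrite -(FK z) Fz wa -hF0 FK.
      exact: zero_ball.
    have [u Du fu] : (f @` (uball R n `\ 0)) w by rewrite hf.
    have -> : z = Some u by rewrite -(FK z) Fz -fu -hFf// FK.
    by case: Du.
  case: z => [u|//] /= u1; have [->|/eqP u0] := eqVneq u 0.
    by rewrite hF0.
  by rewrite hFf//; case: (fD u).
have ballG z : hball (G z) <-> hball z by rewrite -{2}(GK z) ballF.
set K := (1 + enorm a) / (1 - enorm a).
have K1 : 1 <= K by rewrite ler_pdivlMr; lra.
have bound p p' : F (Some p) = Some p' -> enorm p <= 1 ->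
    cassinian_ratio (f x) (f y) p' <= K * cassinian_ratio x y p /\
    cassinian_ratio x y p <= K * cassinian_ratio (f x) (f y) p'.
  move=> Fp p1; apply: (cassinian_ratio_bound FG ballF hF0) => //.
  - by case: hx => /ltW.
  - by case: hy => /ltW.
  - exact: hFf.
  - exact: hFf.
split; last first.
- apply: scassinian_le => //.
  + exact: cassinian_ratio_bounded.
  + by exists a; rewrite boundary_punctured_ball//; left.
  move=> p'; rewrite boundary_punctured_ball// => -[->|p'1].
    exists 0; first by rewrite boundary_punctured_ball//; left.
    by have [] := bound 0 a hF0 (ltW zero_ball).
  have [p Gp p1] := sphere_to_sphere (moebius_likeV FG) ballG p'1.
  exists p; first by rewrite boundary_punctured_ball//; right.
  by have [] // := bound p p'; rewrite ?p1// -Gp GK.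
- rewrite -[X in X * _]invf_div -/K ler_pdivrMl; last exact: lt_le_trans K1.
  apply: scassinian_le => //.
  + by apply: cassinian_ratio_bounded => //; exact: fD.
  + by exists 0; rewrite boundary_punctured_ball//; left.
  move=> p; rewrite (boundary_punctured_ball hn zero_ball) => -[->|p1].
    exists a; first by rewrite boundary_punctured_ball//; left.
    by have [] := bound 0 a hF0 (ltW zero_ball).
  have [p' Fp p'1] := sphere_to_sphere FG ballF p1.
  exists p'; first by rewrite boundary_punctured_ball//; right.
  by have [] // := bound p p' Fp; rewrite p1.
Qed.
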